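(* Let $s\geq 2$, let $n=2^{s-1}$, let $H\leq\mathbb{F}_2^s$ be a hyperplane (a linear subspace of codimension $1$), and let $M=[v_0,v_1,\ldots,v_{n-1}]$ be a list of $n$ nonzero vectors of $\mathbb{F}_2^s$ (repetitions allowed) with $\sum_{i=0}^{n-1}v_i=0$. Suppose that exactly two of the indices $i\in\{0,\ldots,n-1\}$ satisfy $v_i\in H$ (so $M$ is a zero-sum two-hole instance with respect to $H$). Then $M$ has a Hadamard pair solution.
   Context: A Hadamard pair solution for a list $M=[v_0,\ldots,v_{n-1}]$ of $n=2^{s-1}$ nonzero vectors of $\mathbb{F}_2^s$ is a partition $\mathbb{F}_2^s=\bigsqcup_{i=0}^{n-1}\{x_i,y_i\}$ of the whole space into $n$ pairs such that $x_i+y_i=v_i$ for every $i$. A vector $v_i\in H$ is called an internal request (or hole) with respect to $H$, and $v_i\notin H$ a crossing request; a two-hole instance with respect to $H$ has exactly two internal requests, counted with multiplicity, all remaining requests being crossing. *)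

(* Defs.v *)
From mathcomp Require Import all_boot all_order all_algebra.

Set Implicit Arguments.
Unset Strict Implicit.
Unset Printing Implicit Defensive.

Import GRing.Theory.
Local Open Scope ring_scope.

Definition hadamard_pair_solution (s : nat)
    (M : (2 ^ s.-1)%N.-tuple 'rV['F_2]_s) : Prop :=
  exists x y : 'I_(2 ^ s.-1) -> 'rV['F_2]_s,
    [/\ forall i, x i != y i,
        forall i j, i != j -> [disjoint [set x i; y i] & [set x j; y j]],
        \bigcup_i [set x i; y i] = [set: 'rV['F_2]_s]
      & forall i, x i + y i = tnth M i].

(* Main.v *)
Require Import Defs.
From mathcomp Require Import all_boot all_order all_algebra.
From mathcomp Require Import all_fingroup zify ring.

(** Identify [H] with [V = F_2^t] and the outer coset with a copy of [V], and
    let [a], [b] be the two internal requests.  A solution in which [a] is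
    served by [{0, a}] inside [H] and [b] by [{y, y + b}] outside amounts to
    placing the crossing requests [h_k] on [V \ {0, a}] by a bijection [p] so
    that [z |-> z + h_(p^-1 z)] is a bijection onto [V \ {y, y + b}].

    For a map [q : V -> V], the determinant of the matrix [chi_v (q z)] vanishes
    unless [q] is bijective.  Choose [r] with [chi_r a = chi_r b = -1].  Summing
    these determinants over all placements [p] and all [y], with weight
    [chi_r y], gives [2 D f], where [D <> 0] is the determinant of the character
    table and [f] is the permanent of the signs [chi_v (h_k)], over [v] outside
    [{0, r}].  Hence it suffices that [f <> 0].

    Writing [chi = 1 - 2 m] with [m] in [{0, 1}] and expanding, [f] is the sum
    over sets [J] of crossing requests of [(-2)^|J| (2^t - 2 - |J|)! I_J], where
    [I_J] counts the injections [J -> V \ {0, r}] along which [m = 1].  The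
    2-adic valuation of [2^j (2^t - 2 - j)!] is at least that of [(2^t - 2)!], and
    larger for [j = 2]; for [|J| >= 3] the number [I_J] is even, and for
    [|J| = 1] the sum of the [I_J] is even because [chi_r] is trivial on
    [a + b].  So [f] and [(2^t - 2)!] have the same 2-adic valuation. *)

Set Implicit Arguments.
Unset Strict Implicit.
Unset Printing Implicit Defensive.

(** * Valuations and parity of counts *)

Lemma logn2_odd m : odd m -> logn 2 m = 0%N.
Proof. by move=> om; rewrite lognE dvdn2 om /= andbF. Qed.

(** For odd [m] both valuations vanish; for even [m] both arguments are halved. *)
Lemma logn2_subX t m : (0 < m < 2 ^ t)%N -> logn 2 (2 ^ t - m) = logn 2 m.
Proof.
elim: t m => [|t IH] m; first by case: m => [|[]].
have [om|em] := boolP (odd m) => /andP[m0 mt].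
  by rewrite !logn2_odd // oddB 1?ltnW // oddX /= om.
have mE : m = (2 * m./2)%N by rewrite mul2n halfK (negPf em) subn0.
have k0 : (0 < m./2 < 2 ^ t)%N by rewrite expnS in mt; lia.
rewrite mE expnS -mulnBr !lognM ?IH //; lia.
Qed.

Lemma logn2_fact_double m : logn 2 (2 * m)`! = (m + logn 2 m`!)%N.
Proof.
elim: m => // m IH; rewrite mulnS !factS !lognM ?muln_gt0 ?fact_gt0 // IH.
rewrite (@logn2_odd (2 * m).+1); last by rewrite /= oddM.
have -> : (2 * m).+2 = (2 * m.+1)%N by lia.
by rewrite lognM // (@logn_prime 2 2) //= ; lia.
Qed.

(** Strong induction by halving: with [k = m./2], the valuation of [m!] is [k] plus that of [k!],
    whatever the parity of [m]. *)
Lemma logn2_fact_lt m : (0 < m)%N -> (logn 2 m`! < m)%N.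
Proof.
elim/ltn_ind: m => m IH m0.
have [om|em] := boolP (odd m).
  have mE : m = (2 * m./2).+1 by rewrite mul2n halfK om; lia.
  rewrite mE factS lognM ?fact_gt0 // logn2_odd ?add0n; last by rewrite /= oddM.
  rewrite logn2_fact_double; have := IH m./2; case: (m./2) mE => // k mE H.
  by have := H _ isT; lia.
have mE : m = (2 * m./2)%N by rewrite mul2n halfK (negPf em) subn0.
by rewrite mE logn2_fact_double; have := IH m./2; lia.
Qed.

(** Passing from [j] to [j + 1] drops the factor [2^t - (j + 2)] from the first factorial and adds
    the factor [j + 2] to the second; these have equal valuations. *)
Lemma logn2_fact_subX t j : (j <= 2 ^ t - 2)%N ->
  logn 2 (2 ^ t - 2)`! = (logn 2 (2 ^ t - 2 - j)`! + logn 2 j.+1`!)%N.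
Proof.
elim: j => [|j IH] jt; first by rewrite subn0 /= logn1 addn0.
rewrite IH ?(ltnW jt) // (subnS _ j).
rewrite -{1}(@prednK (2 ^ t - 2 - j)); last lia.
rewrite factS lognM ?fact_gt0 // prednK; last lia.
rewrite (factS j.+1) lognM ?fact_gt0 //.
rewrite -subnDA add2n (@logn2_subX t j.+2); lia.
Qed.

(** The points moved by [f] are removed in pairs [{x, f x}]. *)
Lemma odd_card_involution (T : finType) (A : {set T}) (f : T -> T) :
    {in A, forall x, f x \in A} -> {in A, involutive f} ->
  odd #|A| = odd #|[set x in A | f x == x]|.
Proof.
move=> fA; rewrite -[#|A|](cardsID [set x | f x == x]) oddD.
set B := A :\: _ => ff.
have -> : A :&: [set x | f x == x] = [set x in A | f x == x].
  by apply/setP => x; rewrite !inE.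
suff /negPf-> : ~~ odd #|B| by rewrite addbF.
have BA x : x \in B -> x \in A by case/setDP.
have fB : {in B, forall x, f x \in B}.
  move=> x /[!inE] /andP[xf xA]; rewrite fA // ff // andbT eq_sym; exact: xf.
have nf : {in B, forall x, f x != x} by move=> x /[!inE] /andP[].
have {}ff : {in B, involutive f} by move=> x /BA /ff.
move: B {BA} fB nf ff => B; move: {2}#|B| (leqnn #|B|) => n.
elim: n B => [|n IH] B.
  by rewrite leqn0 cards_eq0 => /eqP->; rewrite cards0.
move=> Bn fB nf ff; have [->|[x xB]] := set_0Vmem B; first by rewrite cards0.
rewrite (cardsD1 x) xB (cardsD1 (f x)) !inE nf // fB //= negbK.
apply: IH => [|y|y|y]; rewrite ?inE.
- by move: Bn; rewrite (cardsD1 x) xB (cardsD1 (f x)) !inE nf // fB //=; lia.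
- case/and3P=> yfx yx yB; rewrite fB // !andbT.
  rewrite (inj_in_eq (can_in_inj ff)) // yx /=.
  by apply: contra yfx => /eqP <-; rewrite ff.
- by case/and3P=> _ _; apply: nf.
- by case/and3P=> _ _; apply: ff.
Qed.

Lemma even_card_free_involution (T : finType) (A : {set T}) (f : T -> T) :
    {in A, forall x, f x \in A} -> {in A, involutive f} ->
    {in A, forall x, f x != x} ->
  ~~ odd #|A|.
Proof.
move=> fA ff nf; rewrite (odd_card_involution fA ff).
by rewrite (_ : [set x in A | f x == x] = set0) ?cards0 //;
   apply/setP => x; rewrite !inE; case: (boolP (x \in A)) => // /nf /negPf.
Qed.

(** * Partial injections with prescribed values: extension to permutations and parity *)

Section PartialInjections.
Variables (T : finType) (D : {set T}).

(** Induction on [#|D|]: an extension from [E :\ x] is corrected at [x] by a transposition, which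
    spares the other values because [rho] is injective. *)
Lemma perm_extension (rho : T -> T) : {in D &, injective rho} ->
  exists s : {perm T}, {in D, s =1 rho}.
Proof.
move: {2}#|D| (erefl #|D|) => n; elim: n D => [|n IH] E.
  by move/cards0_eq => -> _; exists 1%g => x; rewrite inE.
move=> En inj; have [x xE] : exists x, x \in E by apply/card_gt0P; rewrite En.
have [|y z|s sE] := IH (E :\ x).
- by move: En; rewrite (cardsD1 x) xE; case.
- by move=> /setD1P[_ yE] /setD1P[_ zE]; apply: inj.
exists (s * tperm (s x) (rho x))%g => y yE; rewrite permM.
have [->|yx] := eqVneq y x; first by rewrite tpermL.
have syE : s y = rho y by apply: sE; rewrite !inE yx.
rewrite tpermD ?syE //.
  by rewrite -syE (inj_eq perm_inj) eq_sym.
by apply: contra yx => /eqP/inj->.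
Qed.

Variables (x0 : T) (Q : T -> pred T).

(** Partial maps on [D] are total functions with the fixed value [x0] off [D], so each one is
    counted once. *)
Definition padded k : pred T := if k \in D then Q k else pred1 x0.

(** Restricting to [D], the fibre over an injection [rho] is a coset of the permutations supported
    off [D], hence has [#|~: D|!] elements. *)
Lemma card_perm_constrained :
  #|[set s : {perm T} | [forall (k | k \in D), Q k (s k)]]| =
  ((#|~: D|)`! * #|[set rho in family padded | dinjectiveb rho D]|)%N.
Proof.
set A := [set s : {perm T} | [forall (k | k \in D), Q k (s k)]].
set B := [set rho in family padded | dinjectiveb rho D].
pose rst (s : {perm T}) : {ffun T -> T} := [ffun k => if k \in D then s k else x0].
have AB s : s \in A -> rst s \in B.
  rewrite !inE => /forall_inP sQ; apply/andP; split.
    apply/familyP => k; rewrite ffunE /padded; case: ifP => [/sQ //|_]; exact: eqxx.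
  by apply/dinjectiveP => k l kD lD; rewrite !ffunE kD lD => /perm_inj.
rewrite -sum1_card (partition_big rst (mem B)) //= mulnC -sum_nat_const.
apply: eq_bigr => rho /[!inE] /andP[/familyP rhoF /dinjectiveP rho_inj].
rewrite -card_perm.
have [s0 s0D] := perm_extension rho_inj.
rewrite sum1dep_card -[RHS](card_imset _ (mulIg s0)); apply: eq_card => s.
apply/idP/imsetP => [|[g gD ->]].
  rewrite !inE => /andP[_ /eqP srho]; exists (s * s0^-1)%g; last by rewrite mulgKV.
  apply/subsetP => k; rewrite !inE permM; apply: contra => kD.
  by rewrite -(inj_eq (@perm_inj _ s0)) permKV s0D // -srho ffunE kD.
have gk k : k \in D -> (g * s0)%g k = rho k.
  by move=> kD; rewrite permM (out_perm gD) ?s0D // !inE negbK.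
rewrite inE; apply/andP; split.
  rewrite inE; apply/forall_inP => k kD; rewrite gk //.
  by have := rhoF k; rewrite /padded kD.
apply/eqP/ffunP => k; rewrite ffunE; case: ifP => [/gk //|kD].
by have := rhoF k; rewrite /padded kD => /eqP.
Qed.


Definition constant_pairs : {set {ffun T -> T} * {perm T}} :=
  [set u | [&& u.1 \in family padded, perm_on D u.2 & [forall k, u.1 (u.2 k) == u.1 k]]].

(* The stabiliser of [rho] under permutations of [D] is trivial when [rho] is
   injective on [D], and otherwise is stable under left multiplication by a
   transposition. *)
Lemma odd_card_injections :
  odd #|[set rho in family padded | dinjectiveb rho D]| = odd #|constant_pairs|.
Proof.
have /fin_all_exists[kl klP] (rho : {ffun T -> T}) : exists kl : T * T,
    ~~ dinjectiveb rho D -> [/\ kl.1 \in D, kl.2 \in D, kl.1 != kl.2 & rho kl.1 = rho kl.2].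
  have [|/dinjectivePn[k kD [l /[!inE] /andP[lk lD] kl]]] := boolP (dinjectiveb rho D).
    by case: (pickP T) => [x _|T0] inj; [exists (x, x) | exists (x0, x0)].
  by exists (k, l); split; rewrite 1?eq_sym.
pose f (u : {ffun T -> T} * {perm T}) : {ffun T -> T} * {perm T} :=
  if dinjectiveb u.1 D then u else (u.1, tperm (kl u.1).1 (kl u.1).2 * u.2)%g.
have fD : {in constant_pairs, forall u, f u \in constant_pairs}.
  move=> [rho p]; rewrite /f /=; case: ifP => // /negbT /klP[kD lD kl_neq klE].
  rewrite !inE /= => /and3P[-> pD /forallP rp] /=; apply/andP; split.
    apply: perm_onM pD; apply/subsetP => z; rewrite inE.
    by case: tpermP => [->|->|]; rewrite ?eqxx.
  apply/forallP => k; rewrite permM (eqP (rp _)).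
  by case: tpermP => [->|->|]; rewrite ?klE.
have ff : {in constant_pairs, involutive f}.
  move=> [rho p] _; rewrite /f /=; case inj: (dinjectiveb rho D) => /=; rewrite inj //.
  by rewrite mulgA tperm2 mul1g.
rewrite (odd_card_involution fD ff); congr odd.
(* The fixed pairs of [f] are the [(rho, 1)] with [rho] injective on [D]: then [rho (p k) = rho k]
   forces [p = 1], and any other pair is moved by its transposition. *)
rewrite -(card_imset _ (can_inj (fun rho => erefl (rho, 1%g : {perm T}).1))).
apply: eq_card => -[rho p]; rewrite !inE /f /=; apply/imsetP/andP.
  case=> rho' /[!inE] /andP[rF inj] [-> ->]; rewrite rF inj eqxx /=; split=> //.
  by rewrite perm_on1; apply/forallP => k; rewrite perm1.
case=> /and3P[rF pD /forallP rp]; case: ifP => [inj _|/negbT/klP[_ _ neq _] /eqP[]].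
  exists rho; first by rewrite !inE rF.
  congr (_, _); apply/permP => k; rewrite perm1.
  have [kD|kD] := boolP (k \in D); last exact: out_perm pD kD.
  by apply: (dinjectiveP _ _ inj); rewrite ?perm_closed //; apply/eqP.
move/permP/(_ ((kl rho).1)); rewrite permM tpermL => /perm_inj /eqP.
by rewrite eq_sym (negPf neq).
Qed.

(* Inverting the permutation cancels all pairs but those of involutions, where
   [g] acts on the values at the orbit [{k, p k}]. *)
Lemma even_card_injections :
    (forall p : {perm T}, perm_on D p -> (forall k, p (p k) = k) ->
      exists k (g : {ffun T -> T}), [/\ k \in D, forall v, g v != v, involutive g,
        forall v, Q k (g v) = Q k v & forall v, Q (p k) (g v) = Q (p k) v]) ->
  ~~ odd #|[set rho in family padded | dinjectiveb rho D]|.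
Proof.
move=> block; rewrite odd_card_injections.
pose f (u : {ffun T -> T} * {perm T}) := (u.1, u.2^-1%g).
have fC : {in constant_pairs, forall u, f u \in constant_pairs}.
  move=> [rho p]; rewrite !inE /= => /and3P[-> pD /forallP rp]; rewrite perm_onV //=.
  by apply/forallP => k; rewrite -(eqP (rp _)) permKV.
have ff : {in constant_pairs, involutive f} by move=> [rho p] _; rewrite /f /= invgK.
rewrite (odd_card_involution fC ff) {fC ff}.
have /fin_all_exists[kg kgP] (p : {perm T}) : exists kg : T * {ffun T -> T},
    perm_on D p -> (forall k, p (p k) = k) ->
    [/\ kg.1 \in D, forall v, kg.2 v != v, involutive kg.2,
        forall v, Q kg.1 (kg.2 v) = Q kg.1 v & forall v, Q (p kg.1) (kg.2 v) = Q (p kg.1) v].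
  have [pD|] := boolP (perm_on D p); last by exists (x0, [ffun=> x0]).
  have [/forallP pp|/forallPn[k kP]] := boolP [forall k, p (p k) == k].
    by case: (block p pD (fun k => eqP (pp k))) => k [g kg]; exists (k, g).
  by exists (x0, [ffun=> x0]) => _ pp; rewrite pp eqxx in kP.
set C := [set u in _ | _].
have inC u : u \in C -> [/\ u.1 \in family padded, perm_on D u.2,
    forall k, u.1 (u.2 k) = u.1 k & forall k, u.2 (u.2 k) = k].
  case: u => rho p; rewrite !inE /= => /andP[/and3P[rF pD /forallP rp]] /eqP[pV].
  by split=> // k; [apply/eqP | rewrite -{1}pV permK].
pose move_block (u : {ffun T -> T} * {perm T}) : {ffun T -> T} * {perm T} :=
  let kg := kg u.2 in
  ([ffun k => if (k == kg.1) || (k == u.2 kg.1) then kg.2 (u.1 k) else u.1 k], u.2).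
apply: (@even_card_free_involution _ _ move_block) => u uC; have [rF pD rp pp] := inC u uC;
  have [kD g_neq gg Qk Qpk] := kgP _ pD pp.
- have uV : u.2^-1%g = u.2.
    by apply/permP => k; apply: (@perm_inj _ u.2); rewrite permKV pp.
  rewrite inE /f /move_block /= uV eqxx andbT inE /= pD /=; apply/andP; split; last first.
    apply/forallP => l; rewrite !ffunE rp (can2_eq pp pp) orbC.
    by rewrite [in X in X || _](inj_eq perm_inj).
  apply/familyP => l; rewrite ffunE /padded.
  have := (familyP rF) l; rewrite /padded.
  case: eqVneq => [->|_] /=; first by rewrite kD /in_mem /= Qk.
  case: eqVneq => [->|_] //=.
  by rewrite perm_closed // kD /in_mem /= Qpk.
- apply: injective_projections => //=; apply/ffunP => l.
  by rewrite !ffunE /=; case: (_ || _); rewrite ?gg.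
apply: contra (g_neq (u.1 (kg u.2).1)) => /eqP/(congr1 fst)/ffunP/(_ (kg u.2).1).
by rewrite /move_block /= ffunE eqxx /= => ->.
Qed.

End PartialInjections.

Import GRing.Theory Num.Theory VectorInternalTheory.
Local Open Scope ring_scope.

(** * Characters and the determinant identity *)

Section Characters.
Variable t : nat.
Notation V := 'rV['F_2]_t.
Implicit Types u v w x y : V.

Definition dot u v : 'F_2 := \sum_i u 0 i * v 0 i.

(** The additive character of [V] indexed by [u], with integer values so that divisibility by powers
    of 2 makes sense. *)
Definition chi u v : int := if dot u v == 0 then 1 else -1.

Lemma F2P (x : 'F_2) : x = 0 \/ x = 1.
Proof. by case: x => [[|[|]]] // i; [left | right]; apply: val_inj. Qed.

Lemma add_self v : v + v = 0.
Proof. by apply/rowP => i; rewrite !mxE; case: (F2P (v 0 i)) => ->; apply: val_inj. Qed.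

Lemma opp_self v : - v = v.
Proof. by apply/esym/eqP; rewrite -addr_eq0 add_self. Qed.

Lemma add_eq0_self u v : (u + v == 0) = (u == v).
Proof. by rewrite addr_eq0 opp_self. Qed.

Lemma add_selfK u v : u + v + v = u.
Proof. by rewrite -addrA add_self addr0. Qed.

Lemma dotC u v : dot u v = dot v u.
Proof. by apply: eq_bigr => i _; rewrite mulrC. Qed.

Lemma dotDl u v w : dot (u + v) w = dot u w + dot v w.
Proof. by rewrite -big_split; apply: eq_bigr => i _; rewrite mxE mulrDl. Qed.

Lemma dotDr u v w : dot u (v + w) = dot u v + dot u w.
Proof. by rewrite !(dotC u) dotDl. Qed.

Lemma dot0l v : dot 0 v = 0.
Proof. by apply: big1 => i _; rewrite mxE mul0r. Qed.

Lemma dot_delta u i : dot u (delta_mx 0 i) = u 0 i.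
Proof.
rewrite /dot (bigD1 i) //= big1 ?addr0 => [|j ji]; rewrite mxE eqxx ?eqxx ?mulr1 //=.
by rewrite (negPf ji) mulr0.
Qed.

Lemma chiC u v : chi u v = chi v u.
Proof. by rewrite /chi dotC. Qed.

Lemma chiDr u v w : chi u (v + w) = chi u v * chi u w.
Proof.
by rewrite /chi dotDr; case: (F2P (dot u v)) => ->; case: (F2P (dot u w)) => ->.
Qed.

Lemma chiDl u v w : chi (u + v) w = chi u w * chi v w.
Proof. by rewrite !(chiC _ w) chiDr. Qed.

Lemma chi0l v : chi 0 v = 1.
Proof. by rewrite /chi dot0l eqxx. Qed.

Lemma chi0r v : chi v 0 = 1.
Proof. by rewrite chiC chi0l. Qed.

Lemma chi_sum (I : finType) (P : pred I) (F : I -> V) u :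
  chi u (\sum_(i | P i) F i) = \prod_(i | P i) chi u (F i).
Proof. exact: (big_morph (chi u) (chiDr u) (chi0r u)). Qed.

(** Orthogonality: translating [y] by a unit vector on which [chi v] is -1 negates the sum. *)
Lemma sum_chi v : \sum_y chi v y = if v == 0 then #|{: V}|%:R else 0.
Proof.
have [->|vn0] := eqVneq v 0.
  by rewrite (eq_bigr (fun=> 1)) ?sumr_const // => y _; rewrite chi0l.
have [i vi] : exists i, v 0 i != 0.
  exact/rV0Pn.
suff: \sum_y chi v y = - \sum_y chi v y by lia.
rewrite {1}(reindex_inj (addrI (delta_mx 0 i))) /= -sumrN.
apply: eq_bigr => y _; rewrite chiDr /chi dot_delta (negPf vi).
by rewrite mulN1r.
Qed.


(** * The character determinant, in Leibniz form with rows and columns indexed by [V] *)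

Definition chidet (q : V -> V) : int :=
  \sum_(s : {perm V}) (-1) ^+ s * \prod_z chi (s z) (q z).

Lemma eq_chidet q q' : q =1 q' -> chidet q = chidet q'.
Proof.
move=> eq; apply: eq_bigr => s _; congr (_ * _).
by apply: eq_bigr => z _; rewrite eq.
Qed.

Lemma chidet_perm (g : {perm V}) q : chidet (fun z => q (g z)) = (-1) ^+ g * chidet q.
Proof.
rewrite /chidet (reindex_inj (mulgI g)) mulr_sumr /=.
apply: eq_bigr => s _; rewrite odd_permM signr_addb mulrA; congr (_ * _).
by rewrite [RHS](reindex_inj (@perm_inj _ g)); apply: eq_bigr => z _; rewrite permM.
Qed.

(** Transposing two points with the same image leaves [q] unchanged but negates the determinant. *)
Lemma chidet_eq0 q : ~~ injectiveb q -> chidet q = 0.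
Proof.
move=> /injectivePn[x [y xy qxy]].
have: chidet q = - chidet q.
  rewrite -[X in _ = - X]mul1r -mulNr -[X in X * _]expr1.
  have <- : (tperm x y : bool) = 1%N :> nat by rewrite odd_tperm xy.
  rewrite -chidet_perm; apply: eq_chidet => z.
  by case: tpermP => // ->.
lia.
Qed.

Lemma chidet_id_neq0 : chidet id != 0.
Proof.
apply/eqP => D0.
have Dq0 q : chidet q = 0.
  have [/injectiveP qi|] := boolP (injectiveb q); last exact: chidet_eq0.
  rewrite (@eq_chidet _ (fun z => id (perm qi z))); last by move=> z; rewrite permE.
  by rewrite (chidet_perm (perm qi) id) D0 mulr0.
(* This is the determinant of the character table times its transpose. Multiplied out it is a
   combination of the vanishing [chidet g]; by orthogonality only the identity contributes, with a
   nonzero power of [#|V|]. *)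
have: \sum_(s : {perm V}) (-1) ^+ s * \prod_z \sum_v chi z v * chi (s z) v = 0.
  under eq_bigr do rewrite (bigA_distr_bigA (fun z v => chi z v * chi (_ z) v)).
  under eq_bigr do rewrite mulr_sumr.
  rewrite exchange_big big1 // => g _.
  under eq_bigr do rewrite big_split mulrCA.
  by rewrite -mulr_sumr [X in _ * X](Dq0 g) mulr0.
rewrite (bigD1 1%g) //= [X in _ + X]big1 => [|s s1].
  rewrite addr0 odd_perm1 mul1r => /eqP/prodf_eq0[z _].
  under eq_bigr do rewrite perm1 -chiDl add_self.
  by rewrite sum_chi eqxx pnatr_eq0 card_mx expn_eq0 card_Fp.
have [z sz] : exists z, s z != z.
  apply/existsP; apply: contraR s1; rewrite negb_exists => /forallP s1.
  by apply/eqP/permP => z; rewrite perm1; apply/eqP; rewrite -[_ == _]negbK s1.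
rewrite (bigD1 z) //=; under eq_bigr do rewrite -chiDl.
by rewrite sum_chi add_eq0_self eq_sym (negPf sz) mul0r mulr0.
Qed.

(** * Weighted sums of determinants over placements *)

Variables (a r : V) (h : V -> V).

(** Requests are indexed by [V] itself, the indices [0] and [a] being reserved for the two internal
    ones. *)
Definition crossing k := (k != 0) && (k != a).

(** The permanent of the signs: a bijection from the crossing indices onto the complement of
    [{0, r}] is encoded as a permutation of [V] with [0] and [a] sent to [r] and [0]. *)
Definition chiper : int :=
  \sum_(s : {perm V} | (s 0 == r) && (s a == 0)) \prod_(k | crossing k) chi (s k) (h k).

Lemma prod_crossing (F : V -> int) : a != 0 ->
  \prod_z F z = F 0 * F a * \prod_(z | crossing z) F z.
Proof. by move=> a_neq0; rewrite (bigD1 0) // (bigD1 a) //= mulrA. Qed.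

Hypothesis ra : chi r a = -1.

Let a_neq0 : a != 0.
Proof. by apply: contra_eqN ra => /eqP ->; rewrite chi0r. Qed.

Lemma sum_chi_weight (s : {perm V}) :
  \sum_y chi r y * (chi (s 0) y * chi (s a) y) =
  if r + s 0 + s a == 0 then #|{: V}|%:R else 0.
Proof. by rewrite -sum_chi; apply: eq_bigr => y _; rewrite !chiDl mulrA. Qed.

(** Let [q y] shift only [0] and [a], by [y]. It is bijective only for [y = 0] (identity) and
    [y = a] (a transposition); both weighted determinants equal [chidet id], as the sign of the
    transposition cancels [chi r a]. Summing over [y] inside the Leibniz expansion leaves the [s]
    with [r + s 0 + s a = 0]. *)
Lemma chidet_weighted :
  \sum_(s : {perm V} | r + s 0 + s a == 0)
     (-1) ^+ s * #|{: V}|%:R * \prod_z chi (s z) z = 2 * chidet id.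
Proof.
pose q y z : V := z + (if crossing z then 0 else y).
have q00 : q 0 =1 id by move=> z; rewrite /q if_same addr0.
have qa z : q a z = tperm 0 a z.
  rewrite /q /crossing; case: tpermP => [->|->|/eqP/negPf-> /eqP/negPf->]; last by rewrite addr0.
    by rewrite eqxx add0r.
  by rewrite eqxx andbF add_self.
transitivity (\sum_y chi r y * chidet (q y)); last first.
  rewrite (bigD1 0) // (bigD1 a) //= [X in _ + (_ + X)]big1 => [|y /andP[y0 ya]].
    rewrite (eq_chidet q00) (eq_chidet qa) (chidet_perm _ id) odd_tperm eq_sym a_neq0.
    by rewrite chi0r ra /= expr1; ring.
  rewrite chidet_eq0 ?mulr0 //; apply/injectivePn; exists 0, y; first by rewrite eq_sym.
  by rewrite /q /crossing eqxx y0 ya /= add0r addr0.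
rewrite /chidet; under [RHS]eq_bigr do rewrite mulr_sumr.
rewrite exchange_big [RHS](bigID (fun s : {perm V} => r + s 0 + s a == 0)) /=.
have E (s : {perm V}) : \sum_y chi r y * ((-1) ^+ s * \prod_z chi (s z) (q y z)) =
   (-1) ^+ s * (if r + s 0 + s a == 0 then #|{: V}|%:R else 0) * \prod_z chi (s z) z.
  rewrite -sum_chi_weight mulr_sumr mulr_suml; apply: eq_bigr => y _.
  rewrite (prod_crossing (fun z => chi (s z) (q y z)) a_neq0).
  rewrite (prod_crossing (fun z => chi (s z) z) a_neq0).
  have -> : \prod_(z | crossing z) chi (s z) (q y z) = \prod_(z | crossing z) chi (s z) z.
    by apply: eq_bigr => z cz; rewrite /q cz addr0.
  rewrite /q /crossing !eqxx andbF /= !chiDr.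
  move: (\prod_(z | _) _) ((-1) ^+ s) (chi (s 0) _) (chi (s 0) _) (chi (s a) _) (chi (s a) _).
  by move: (chi r y) => *; ring.
rewrite [X in _ + X]big1 ?addr0 => [|s /negPf s0].
  by apply: eq_bigr => s /eqP s0; rewrite E s0 eqxx.
by rewrite E s0 mulr0 mul0r.
Qed.

Let c := \sum_(k | crossing k) h k.

Let fixed (p : {perm V}) := (p 0 == 0) && (p a == a).

(** Composing with [s] and then translating by [s a] turns the [p] fixing [0] and [a] into the
    permutations of [chiper]; the translation costs [chi (s a)] at each [h k], that is [chi (s a) c]
    in all. *)
Lemma chiper_shift (s : {perm V}) : r + s 0 + s a == 0 ->
  \sum_(p | fixed p) \prod_(k | crossing k) chi (s (p k)) (h k) = chi (s a) c * chiper.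
Proof.
move=> s0; pose sh := perm (addIr (s a)).
rewrite /chiper [X in _ * X](reindex_inj (mulIg (s * sh)%g)) mulr_sumr /=.
have rE : r = s 0 + s a by apply/eqP; rewrite -add_eq0_self addrA.
apply: eq_big => [p|p _].
  rewrite /fixed !permM !permE rE (inj_eq (addIr _)) (inj_eq perm_inj).
  by rewrite add_eq0_self (inj_eq perm_inj).
rewrite /c chi_sum -big_split; apply: eq_bigr => k _ /=.
by rewrite !permM permE chiDl mulrC -mulrA -chiDl add_self chi0l mulr1.
Qed.

(** The outer points in use. Under the zero-sum condition [a + c] is the second internal request, so
    [0] and [a] carry the two ends of its pair; any other [z] carries the partner of [z]. *)
Definition placement (p : {perm V}) y z : V :=
  if z == 0 then y else if z == a then y + (a + c) else z + h (p^-1%g z).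

(** The sum over [y] selects the [s] with [r + s 0 + s a = 0]; the factor [chi (s a) c] from the
    value at [a] cancels the one in [chiper_shift], leaving [chidet_weighted] times [chiper]. *)
Lemma sum_chidet_placement :
  \sum_y chi r y * \sum_(p | fixed p) chidet (placement p y) = 2 * chidet id * chiper.
Proof.
rewrite -chidet_weighted mulr_suml.
have E (s p : {perm V}) y : fixed p -> \prod_z chi (s z) (placement p y z) =
   chi (s 0) y * chi (s a) y * chi (s a) c * (\prod_z chi (s z) z) *
   \prod_(k | crossing k) chi (s (p k)) (h k).
  case/andP=> /eqP p0 /eqP pa.
  rewrite (prod_crossing (fun z => chi (s z) (placement p y z)) a_neq0).
  rewrite (prod_crossing (fun z => chi (s z) z) a_neq0).
  have -> : \prod_(z | crossing z) chi (s z) (placement p y z) =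
      (\prod_(z | crossing z) chi (s z) z) * \prod_(k | crossing k) chi (s (p k)) (h k).
    rewrite [X in _ * X](reindex_inj (@perm_inj _ (p^-1)%g)) /=.
    have cp z : crossing (p^-1%g z) = crossing z.
      by rewrite /crossing -{1}(permK p 0) -{1}(permK p a) p0 pa !(inj_eq perm_inj).
    under [X in _ = _ * X]eq_bigl do rewrite cp.
    rewrite -big_split; apply: eq_bigr => z /andP[z0 za].
    by rewrite /placement (negPf z0) (negPf za) chiDr permKV.
  rewrite /placement !eqxx (negPf a_neq0) !chiDr chi0r.
  move: (\prod_(z | _) _) (\prod_(z | _) _) => P Q.
  by move: (chi (s 0) y) (chi (s a) y) (chi (s a) a) (chi (s a) c) => *; ring.
rewrite /chidet; under eq_bigr do rewrite exchange_big mulr_sumr /=.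
rewrite exchange_big [RHS]big_mkcond /=; apply: eq_bigr => s _.
transitivity (\sum_y chi r y * (chi (s 0) y * chi (s a) y) * ((-1) ^+ s * chi (s a) c *
   (\prod_z chi (s z) z) * \sum_(p | fixed p) \prod_(k | crossing k) chi (s (p k)) (h k))).
  apply: eq_bigr => y _; rewrite -mulrA !mulr_sumr; apply: eq_bigr => p fp; rewrite (E _ _ _ fp).
  move: (\prod_(k | crossing k) chi (s (p k)) (h k)) (\prod_z chi (s z) z) ((-1) ^+ s).
  by move: (chi r y) (chi (s 0) y) (chi (s a) y) (chi (s a) c) => *; ring.
rewrite -mulr_suml sum_chi_weight; case: ifP => [s0|_]; last by rewrite mul0r.
rewrite (chiper_shift s0).
have cc : chi (s a) c * chi (s a) c = 1 by rewrite -chiDr add_self chi0r.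
move: (chi (s a) c) cc (\prod_z _) chiper ((-1) ^+ s) (#|_|%:R) => C cc P f g N.
by transitivity (N * g * P * f * (C * C)); [ring | rewrite cc; ring].
Qed.

Lemma placement_exists : chiper != 0 -> exists p y, fixed p /\ injective (placement p y).
Proof.
move=> f0; have [/existsP[y /existsP[p /andP[fp /injectiveP]]]|] :=
  boolP [exists y, exists p, fixed p && injectiveb (placement p y)].
  by exists p, y.
move=> none; have := sum_chidet_placement; rewrite big1 => [|y _].
  move/esym/eqP; rewrite !mulf_eq0 (negPf f0) (negPf chidet_id_neq0) orbF orbF.
  by rewrite (pnatr_eq0 _ 2).
rewrite big1 ?mulr0 // => p fp; apply: chidet_eq0; apply: contra none => inj.
by apply/existsP; exists y; apply/existsP; exists p; rewrite fp.
Qed.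

End Characters.

(** * Nonvanishing of the permanent *)

Section Nonvanishing.
Variable t : nat.
Notation V := 'rV['F_2]_t.
Variables (a r : V) (h : V -> V).
Hypotheses (a_neq0 : a != 0) (r_neq0 : r != 0).
(** At a crossing [k], the rows with sign -1; at [0] and [a] the values are pinned as in [chiper]. A
    set [J] of crossing indices thus corresponds to [D] with [#|D| = #|J| + 2]. *)
Definition minus_at k : pred V :=
  fun v => if k == 0 then v == r else if k == a then v == 0 else dot v (h k) != 0.

Definition injections (D : {set V}) :=
  [set rho in family (padded D 0 minus_at) | dinjectiveb rho D].

Lemma card_V : #|{: V}| = (2 ^ t)%N.
Proof. by rewrite card_mx card_Fp // mul1n. Qed.

(** Each sign is the sum of [F] (-2 times an indicator) and [G] (equal to 1) at crossing indices. At
    [0] and [a] the term [G] is zero, so only the [D] containing both survive. *)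
Lemma chiper_expand : chiper a r h =
  \sum_(D : {set V} | (0 \in D) && (a \in D))
    (-2) ^+ (#|D| - 2) * ((2 ^ t - #|D|)`! * #|injections D|)%:R.
Proof.
pose F (s : {perm V}) z : int := (if crossing a z then -2 else 1) * (minus_at z (s z))%:R.
pose G (s : {perm V}) z : int := (crossing a z)%:R.
transitivity (\sum_s \prod_z (F s z + G s z)).
  rewrite /chiper big_mkcond; apply: eq_bigr => s _.
  rewrite (prod_crossing _ a_neq0) {1 2}/F {1 2}/G /minus_at /crossing.
  rewrite !eqxx andbF (negPf a_neq0) !addr0 !mul1r.
  case: (s 0 == r); rewrite ?mul0r // mul1r; case: (s a == 0); rewrite ?mul0r // mul1r.
  apply: eq_bigr => z cz; rewrite /F /G /crossing cz /minus_at /chi.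
  by case/andP: cz => /negPf-> /negPf->; case: (_ == 0).
under eq_bigr do rewrite bigA_distr.
rewrite exchange_big [RHS]big_mkcond /=; apply: eq_bigr => D _.
case: ifP => [/andP[D0 Da]|]; last first.
  move=> D0a; apply: big1 => s _; have [D0|D0] := boolP (0 \in D).
    have Da : a \notin D by move: D0a; rewrite D0 /= => ->.
    by rewrite (bigD1 a) // (negPf Da) /G /crossing eqxx andbF /= mul0r.
  by rewrite (bigD1 0) // (negPf D0) /G /crossing eqxx /= mul0r.
have -> : (2 ^ t - #|D|)%N = #|~: D| by rewrite -card_V -(cardsC D) addKn.
rewrite -card_perm_constrained -sum1_card natr_sum [X in _ = _ * X]big_mkcond mulr_sumr.
apply: eq_bigr => s _; rewrite inE.
have -> : \prod_z (if z \in D then F s z else G s z) =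
   (\prod_(z in D) if crossing a z then -2 else 1) * \prod_(z in D) (minus_at z (s z))%:R.
  rewrite -big_split [RHS]big_mkcond; apply: eq_bigr => z _; case: ifP => // zD.
  rewrite /G /crossing; case: eqVneq zD => [->|_]; first by rewrite D0.
  by case: eqVneq => [->|//]; rewrite Da.
congr (_ * _).
  rewrite -big_mkcondr prodr_const; congr (_ ^+ _).
  rewrite (cardsD1 0) D0 (cardsD1 a) !inE a_neq0 Da /= add1n add1n subn2 /=.
  by apply: eq_card => z; rewrite !inE unfold_in andbC -andbA andbCA.
case: ifP => [/forall_inP sQ|].
  by apply: big1 => z zD; rewrite sQ.
move/negbT; rewrite negb_forall_in => /exists_inP[z zD nQ].
by rewrite (bigD1 z) //= (negPf nQ) mul0r.
Qed.

Lemma injectionsP (D : {set V}) (rho : {ffun V -> V}) :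
  reflect [/\ {in D, forall k, minus_at k (rho k)}, forall k, k \notin D -> rho k = 0
             & {in D &, injective rho}] (rho \in injections D).
Proof.
rewrite inE; apply: (iffP andP) => [[/familyP rF /dinjectiveP inj]|[rD rD' inj]].
  split=> // k kD; have := rF k; rewrite /padded.
    by rewrite kD.
  by rewrite (negPf kD) => /eqP.
split; last exact/dinjectiveP.
apply/familyP => k; rewrite /padded; case: ifP => [/rD //|/negbT/rD' ->]; exact: eqxx.
Qed.

Lemma minus_at0 v : minus_at 0 v = (v == r).
Proof. by rewrite /minus_at eqxx. Qed.

Lemma minus_ata v : minus_at a v = (v == 0).
Proof. by rewrite /minus_at eqxx (negPf a_neq0). Qed.

Lemma minus_at_crossing k v : crossing a k -> minus_at k v = (dot v (h k) != 0).
Proof. by case/andP=> /negPf k0 /negPf ka; rewrite /minus_at k0 ka. Qed.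

Lemma injections_base : #|injections [set 0; a]| = 1%N.
Proof.
apply/eqP/cards1P; exists [ffun z => if z == 0 then r else 0]; apply/setP => rho.
rewrite inE; apply/injectionsP/eqP => [[rD rD' _]|->].
  apply/ffunP => z; rewrite ffunE; case: eqVneq => [->|z0].
    by apply/eqP; rewrite -minus_at0 rD // !inE eqxx.
  have [->|za] := eqVneq z a; last by rewrite rD' // !inE negb_or z0.
  by apply/eqP; rewrite -minus_ata rD // !inE eqxx orbT.
split=> [k /set2P[]->|k|x y /set2P[->|->] /set2P[->|->]]; rewrite !ffunE ?eqxx ?(negPf a_neq0) //.
- by rewrite minus_at0.
- by rewrite minus_ata.
- by rewrite !inE => /norP[/negPf->].
- by move/eqP; rewrite (negPf r_neq0).
by move/esym/eqP; rewrite (negPf r_neq0).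
Qed.

(** * Parity of the injection counts *)

Lemma orthogonal_pair u v : (4 < #|{: V}|)%N ->
  exists w : V, [/\ w != 0, dot w u = 0 & dot w v = 0].
Proof.
move=> V4; pose f (w : V) : 'F_2 * 'F_2 := (dot w u, dot w v).
have /injectivePn[w1 [w2 w12 [E1 E2]]] : ~~ injectiveb f.
  by apply: contraL V4 => /injectiveP/leq_card; rewrite card_prod !card_Fp // -leqNgt.
exists (w1 + w2); split; first by rewrite add_eq0_self.
  by rewrite dotDl E1; case: (F2P (dot w2 u)) => ->; apply: val_inj.
by rewrite dotDl E2; case: (F2P (dot w2 v)) => ->; apply: val_inj.
Qed.

Lemma orthogonal_vector u : (2 < #|{: V}|)%N -> exists w : V, w != 0 /\ dot w u = 0.
Proof.
move=> V2; have /injectivePn[w1 [w2 w12 E]] : ~~ injectiveb (fun w => dot w u).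
  by apply: contraL V2 => /injectiveP/leq_card; rewrite card_Fp // -leqNgt.
exists (w1 + w2); split; first by rewrite add_eq0_self.
by rewrite dotDl E; case: (F2P (dot w2 u)) => ->; apply: val_inj.
Qed.

(** The only free value, at [k], ranges over the set [B] with [r] removed, and [B] is even by
    translation along a vector orthogonal to [h k]. The value [0] is never in [B]. *)
Lemma odd_injections1 k : crossing a k ->
  odd #|injections (k |: [set 0; a])| = (dot r (h k) != 0).
Proof.
move=> /andP[k0 ka].
have V2 : (2 < #|{: V}|)%N.
  apply: leq_trans (max_card (mem (k |: [set 0; a]))).
  by rewrite cardsU1 !inE negb_or k0 ka cards2 eq_sym a_neq0.
pose B := [set v | dot v (h k) != 0].
have evenB : ~~ odd #|B|.
  have [w [w0 wk]] := orthogonal_vector (h k) V2.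
  apply: (@even_card_free_involution _ _ (fun v => v + w)) => v; rewrite !inE.
  - by rewrite dotDl wk addr0.
  - by rewrite add_selfK.
  - by rewrite -add_eq0_self addrAC add_self add0r.
pose rho v : {ffun V -> V} := [ffun z => if z == 0 then r else if z == k then v else 0].
have rho_inj : injective rho.
  by move=> v v' /ffunP/(_ k); rewrite !ffunE (negPf k0) eqxx.
have -> : injections (k |: [set 0; a]) = rho @: (B :\ r).
  apply/setP => f; apply/injectionsP/imsetP => [[fD fD' inj]|[v /setD1P[vr]]].
    have f0 : f 0 = r by apply/eqP; rewrite -minus_at0 fD // !inE eqxx orbT.
    exists (f k).
      rewrite !inE -minus_at_crossing ?fD ?inE ?eqxx ?andbT //; last exact/andP.
      by rewrite -f0 (inj_in_eq inj) // !inE eqxx ?orbT.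
    apply/ffunP => z; rewrite ffunE; case: (eqVneq z 0) => [->//|z0].
    case: (eqVneq z k) => [->//|zk].
    have [->|za] := eqVneq z a; last by rewrite fD' // !inE !negb_or zk z0.
    by apply/eqP; rewrite -minus_ata fD // !inE eqxx !orbT.
  rewrite inE => vk ->.
  have v0 : v != 0 by apply: contraNneq vk => ->; rewrite dot0l.
  have E0 : rho v 0 = r by rewrite ffunE eqxx.
  have Ea : rho v a = 0 by rewrite ffunE (negPf a_neq0) eq_sym (negPf ka).
  have Ek : rho v k = v by rewrite ffunE (negPf k0) eqxx.
  split=> [x|x|x y]; rewrite !inE.
  - case/or3P=> /eqP->; rewrite ?minus_at0 ?minus_ata ?E0 ?Ea ?eqxx //.
    by rewrite minus_at_crossing ?Ek //; apply/andP.
  - by rewrite ffunE => /norP[/negPf-> /norP[/negPf->]].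
  case/or3P=> /eqP->; case/or3P=> /eqP->; rewrite ?E0 ?Ea ?Ek // => /eqP;
    by rewrite ?(negPf vr) ?(negPf v0) ?(negPf r_neq0) // eq_sym
               ?(negPf vr) ?(negPf v0) ?(negPf r_neq0).
rewrite (card_imset _ rho_inj).
have := cardsD1 r B; rewrite inE => BE.
by move: evenB; rewrite BE oddD; case: (dot r (h k) != 0); case: (odd #|_|).
Qed.

(** With more than four elements, [D] has a [k] such that [k] and [p k] both avoid [0] and [a];
    translation by a nonzero vector orthogonal to [h k] and [h (p k)] preserves both constraints. *)
Lemma even_injections (D : {set V}) : 0 \in D -> a \in D -> (4 < #|D|)%N ->
  ~~ odd #|injections D|.
Proof.
move=> D0 Da D4; apply: even_card_injections => p pD pp.
have [k kP] : exists k, k \in D :\: [set 0; a; p 0; p a].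
  apply/card_gt0P; rewrite cardsD subn_gt0; apply: leq_trans D4; rewrite ltnS.
  apply: leq_trans (subset_leq_card (subsetIr _ _)) _.
  do 2![apply: leq_trans (leq_card_setU _ _) _; rewrite cards1 addn1 ltnS].
  by rewrite cards2; case: (_ != _).
move: kP; rewrite !inE !negb_or => /andP[/andP[/andP[/andP[k0 ka] kp0] kpa] kD].
have [w [w0 wk wpk]] := orthogonal_pair (h k) (h (p k)) (leq_trans D4 (max_card _)).
have pk z : k != p z -> p k != z by apply: contra => /eqP <-; rewrite pp.
exists k, [ffun v => v + w]; split=> // v; rewrite ?ffunE.
- by rewrite -add_eq0_self addrAC add_self add0r.
- by rewrite add_selfK.
- by rewrite /minus_at (negPf k0) (negPf ka) dotDl wk addr0.
- by rewrite /minus_at (negPf (pk _ kp0)) (negPf (pk _ kpa)) dotDl wpk addr0.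
Qed.

Let v2 := logn 2 (2 ^ t - 2)`!.

Lemma dvdn_term j : (j <= 2 ^ t - 2)%N -> (2 ^ v2 %| 2 ^ j * (2 ^ t - 2 - j)`!)%N.
Proof.
move=> jt; rewrite pfactor_dvdn // ?muln_gt0 ?expn_gt0 ?fact_gt0 //.
rewrite lognM ?expn_gt0 ?fact_gt0 // pfactorK // /v2 (logn2_fact_subX jt).
by have := @logn2_fact_lt j.+1 isT; lia.
Qed.

(** The extra factor 2 arises because [3!] has valuation 1, less than 2. *)
Lemma dvdn_term2 : (2 <= 2 ^ t - 2)%N -> (2 ^ v2.+1 %| 2 ^ 2 * (2 ^ t - 2 - 2)`!)%N.
Proof.
move=> jt; rewrite pfactor_dvdn // ?muln_gt0 ?expn_gt0 ?fact_gt0 //.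
rewrite lognM ?expn_gt0 ?fact_gt0 // pfactorK // /v2 (logn2_fact_subX jt).
by rewrite (_ : logn 2 3`! = 1%N) //; lia.
Qed.

Lemma signed_count_crossing :
  chi r (\sum_(k | crossing a k) h k) = (-1) ^+ (\sum_(k | crossing a k) (dot r (h k) != 0%R)).
Proof.
rewrite chi_sum -prodrXr; apply: eq_bigr => k _; rewrite /chi.
by case: (_ == 0).
Qed.

Lemma odd_sum_injections3 : chi r (\sum_(k | crossing a k) h k) = 1 ->
  ~~ odd (\sum_(D : {set V} | [&& 0 \in D, a \in D & #|D| == 3%N]) #|injections D|).
Proof.
rewrite signed_count_crossing -signr_odd => odd_cross.
pose f k := k |: [set 0; a].
have f3 k : crossing a k -> #|f k| = 3%N.
  by case/andP=> k0 ka; rewrite cardsU1 !inE negb_or k0 ka cards2 eq_sym a_neq0.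
have f_inj : {in [set k | crossing a k] &, injective f}.
  move=> k l; rewrite !inE => /andP[k0 ka] _ /setP/(_ k).
  by rewrite !inE eqxx (negPf k0) (negPf ka) !orbF => /esym/eqP.
rewrite (eq_bigl (mem (f @: [set k | crossing a k]))); last first.
  move=> D; apply/and3P/imsetP => [[D0 Da /eqP D3]|[k]]; last first.
    by rewrite inE => ck ->; rewrite f3 // !inE !eqxx !orbT.
  have /cards1P[k Dk] : #|D :\ 0 :\ a| == 1%N.
    move: D3; rewrite (cardsD1 (0 : V)) D0 (cardsD1 a) !inE a_neq0 Da => /eqP.
    by rewrite !add1n !eqSS.
  have ck : crossing a k.
    by have := set11 k; rewrite -Dk !inE => /and3P[? ? _]; apply/andP.
  exists k; first by rewrite inE.
  apply/setP => x; rewrite /f -Dk !inE.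
  have [->|xa] := eqVneq x a; first by rewrite Da !orbT.
  by have [->|x0] := eqVneq x 0; rewrite ?D0 ?orbT ?orbF.
rewrite big_imset //= (eq_bigl (crossing a)); last by move=> k; rewrite inE.
have -> : odd (\sum_(k | crossing a k) #|injections (f k)|) =
          odd (\sum_(k | crossing a k) (dot r (h k) != 0%R)).
  rewrite !(big_morph odd oddD (erefl _)); apply: eq_bigr => k ck.
  by rewrite odd_injections1 //; case: (_ != 0).
by case: odd odd_cross.
Qed.

(** Modulo [2^(v2 + 1)] only the term [D = {0, a}] survives; it equals [(2^t - 2)!], which is not
    divisible by this modulus. *)
Lemma chiper_neq0 : chi r (\sum_(k | crossing a k) h k) = 1 -> chiper a r h != 0.
Proof.
move=> rc; pose d : int := (2 ^ v2.+1)%N.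
suff: (d %| chiper a r h - ((2 ^ t - 2)`!)%N%:R)%Z.
  apply: contraL => /eqP->; rewrite sub0r natz dvdzE abszN !absz_nat.
  by rewrite pfactor_dvdn ?fact_gt0 // ltnn.
have c2 : #|[set 0; a]| = 2%N by rewrite cards2 eq_sym a_neq0.
have cD (D : {set V}) : (0 \in D) && (a \in D) -> (2 <= #|D| <= 2 ^ t)%N.
  case/andP=> D0 Da; rewrite -card_V max_card andbT.
  have /subset_leq_card : [set 0; a] \subset D by apply/subsetP => x /set2P[->|->].
  by rewrite c2.
rewrite chiper_expand (bigD1 [set 0; a]) ?inE ?eqxx ?orbT //= c2 subnn expr0 mul1r.
rewrite injections_base muln1 addrAC subrr add0r (bigID (fun D : {set V} => #|D| == 3%N)) /=.
apply: rpredD.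
  rewrite (eq_bigr (fun D => (-2 * (2 ^ t - 3)`!%:R) * #|injections D|%:R)); last first.
    by move=> D /andP[_ /eqP->]; rewrite expr1 natrM mulrA.
  rewrite -mulr_sumr -natr_sum.
  rewrite (eq_bigl (fun D : {set V} => [&& 0 \in D, a \in D & #|D| == 3%N])); last first.
    move=> D; rewrite -andbA -andbA; case: (0 \in D); case: (a \in D) => //=.
    by case: (eqVneq D [set 0; a]) => [->|//]; rewrite c2.
  have := odd_sum_injections3 rc; set S := (\sum_(D | _) _)%N => S_even.
  (* A nonzero [S] yields a set of size 3, hence the bound on [2^t] required by [dvdn_term] at
     [j = 1]. *)
  have [->|S0] := eqVneq S 0%N; first by rewrite mulr0 rpred0.
  have [D /andP[D0a /eqP D3]] : exists D : {set V}, ((0 \in D) && (a \in D)) && (#|D| == 3%N).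
    have : S != 0%N := S0; rewrite /S sum_nat_eq0 negb_forall => /existsP[D].
    by rewrite negb_imply andbA => /andP[H _]; exists D.
  have /= := @dvdn_term 1; rewrite -subnDA => dv.
  have {}dv : (2 ^ v2 %| 2 ^ 1 * (2 ^ t - 3)`!)%N by apply: dv; have := cD D D0a; lia.
  rewrite mulNr mulNr rpredN -(natrM _ 2) -natrM natz /d.
  rewrite dvdzE !absz_nat expnS mulnC.
  by apply: dvdn_mul => //; rewrite dvdn2.
apply: rpred_sum => D /andP[/andP[D0a D2] D3].
have [D0 Da] := andP D0a; have := cD D D0a => DD.
have D4 : (4 <= #|D|)%N.
  have : #|D| != 2%N.
    apply: contra D2 => /eqP D2; rewrite eq_sym eqEcard c2 D2 leqnn andbT.
    by apply/subsetP => x /set2P[->|->].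
  by case/andP: DD; move: D3; move: #|D| => m; lia.
have tE : (2 ^ t - #|D|)%N = (2 ^ t - 2 - (#|D| - 2))%N by lia.
rewrite exprNn -mulrA; apply: dvdz_mull; rewrite tE.
rewrite -(natrX _ 2) -natrM natz /d dvdzE !absz_nat mulnA.
(* For size 4 the coefficient supplies the extra factor 2; for larger sets the count of injections
   does. *)
have [D4E|D5] := eqVneq #|D| 4%N.
  by apply: dvdn_mulr; rewrite D4E; apply: dvdn_term2; lia.
rewrite expnSr; apply: dvdn_mul; first by apply: dvdn_term; move: DD; move: #|D| => m; lia.
by rewrite dvdn2 even_injections //; move: D4 D5; move: #|D| => m; lia.
Qed.

End Nonvanishing.

(** * Back to pair solutions *)

(** If neither unit vector, taken at a nonzero coordinate of [a] or of [b], works for both, their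
    sum does. *)
Lemma exists_nonorthogonal t (a b : 'rV['F_2]_t) : a != 0 -> b != 0 ->
  exists r, dot r a != 0 /\ dot r b != 0.
Proof.
move=> /rV0Pn[i ai] /rV0Pn[j bj].
have dotE v k : dot (delta_mx 0 k) v = v 0 k by rewrite dotC dot_delta.
have [bi|bi] := eqVneq (b 0 i) 0; last by exists (delta_mx 0 i); rewrite !dotE.
have [aj|aj] := eqVneq (a 0 j) 0; last by exists (delta_mx 0 j); rewrite !dotE.
by exists (delta_mx 0 i + delta_mx 0 j); rewrite !dotDl !dotE aj bi addr0 add0r.
Qed.

Lemma bipartite_placement t (a b : 'rV['F_2]_t) (h : 'rV['F_2]_t -> 'rV['F_2]_t) :
    a != 0 -> b != 0 -> b = a + \sum_(k | crossing a k) h k ->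
  exists (p : {perm 'rV['F_2]_t}) y, [/\ p 0 = 0, p a = a & injective (placement a h p y)].
Proof.
move=> a0 b0 bE; have [r [ra rb]] := exists_nonorthogonal a0 b0.
have chia : chi r a = -1 by rewrite /chi (negPf ra).
have chib : chi r b = -1 by rewrite /chi (negPf rb).
have r0 : r != 0 by apply: contraNneq ra => ->; rewrite dot0l.
have chic : chi r (\sum_(k | crossing a k) h k) = 1.
  by have := chib; rewrite bE chiDr chia mulN1r => /oppr_inj.
have [p [y [/andP[/eqP p0 /eqP pa] inj]]] := placement_exists chia (chiper_neq0 a0 r0 chic).
by exists p, y.
Qed.

Lemma hadamard_pair_solution_of_injection s (M : (2 ^ s.-1)%N.-tuple 'rV['F_2]_s)
    (f : 'I_(2 ^ s.-1) * bool -> 'rV['F_2]_s) :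
    (0 < s)%N -> injective f -> (forall i, f (i, false) + f (i, true) = tnth M i) ->
  hadamard_pair_solution M.
Proof.
move=> s0 f_inj fM; exists (fun i => f (i, false)), (fun i => f (i, true)); split=> //.
- by move=> i; rewrite (inj_eq f_inj) xpair_eqE andbF.
- move=> i j ij; rewrite -setI_eq0; apply/eqP/setP => z; rewrite !inE.
  apply/negP => /andP[/orP[]/eqP-> /orP[]/eqP/f_inj[E]]; by rewrite E eqxx in ij.
apply/setP => z; rewrite inE; apply/bigcupP.
have [g fg gf] : bijective f.
  apply: inj_card_bij f_inj _.
  by rewrite card_mx card_Fp // mul1n card_prod card_ord card_bool -expnSr prednK.
case E : (g z) => [i c]; exists i => //; rewrite !inE -(gf z) E.
by case: c {E}; rewrite eqxx ?orbT.
Qed.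

Lemma exists_bijection_through (T U : finType) (x y : T) (i j : U) :
    #|T| = #|U| -> x != y -> i != j ->
  exists b : T -> U, [/\ bijective b, b x = i & b y = j].
Proof.
move=> TU xy ij; pose f z := enum_val (cast_ord TU (enum_rank z)).
have f_inj : injective f by move=> z w /enum_val_inj /cast_ord_inj /enum_rank_inj.
pose g u := if u == f x then i else j.
have [|q qE] := @perm_extension _ [set f x; f y] g.
  have yx : f y != f x by rewrite (inj_eq f_inj) eq_sym.
  move=> u w /set2P[->|->] /set2P[->|->]; rewrite /g ?eqxx ?(negPf yx) // => /eqP;
    by rewrite ?(negPf ij) // eq_sym (negPf ij).
exists (fun z => q (f z)); split.
- by apply: inj_card_bij; [move=> z w /perm_inj /f_inj | rewrite TU].
- have -> : q (f x) = g (f x) by apply: qE; rewrite !inE eqxx.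
  by rewrite /g eqxx.
- have -> : q (f y) = g (f y) by apply: qE; rewrite !inE eqxx orbT.
  by rewrite /g (inj_eq f_inj) eq_sym (negPf xy).
Qed.

(** By dimension [H] and [u] span the space, and [v] has coefficient 1 along [u]. *)
Lemma add_notin_hyperplane s (H : {vspace 'rV['F_2]_s}) (u v : 'rV['F_2]_s) :
  (\dim H).+1 = s -> u \notin H -> v \notin H -> u + v \in H.
Proof.
move=> dimH uH vH; have u0 : u != 0 by apply: contraNneq uH => ->; rewrite mem0v.
have full : (H + <[u]>)%VS = fullv.
  apply/eqP; rewrite eqEdim subvf dimvf /dim /= mul1n -{1}dimH.
  rewrite dimv_disjoint_sum ?dim_vline ?u0 ?addn1 //.
  apply/eqP; rewrite -subv0; apply/subvP => w /memv_capP[wH /vlineP[k wE]].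
  have [k0|k1] := F2P k; first by rewrite wE k0 scale0r mem0v.
  by rewrite wE k1 scale1r (negPf uH) in wH.
have /memv_addP[w wH [z /vlineP[k ->] vE]] : v \in (H + <[u]>)%VS by rewrite full memvf.
have [k0|k1] := F2P k; first by rewrite vE k0 scale0r addr0 wH in vH.
by rewrite vE k1 scale1r addrCA add_self addr0.
Qed.

Lemma exists_coordinates s (H : {vspace 'rV['F_2]_s}) :
  exists f : 'rV['F_2]_(\dim H) -> 'rV['F_2]_s,
    [/\ injective f, {morph f : u v / u + v}, forall u, f u \in H &
        forall v, v \in H -> exists u, f u = v].
Proof.
exists (fun u => vsval (r2v (u : 'rV['F_2]_(dim (subvs_of H))))); split.
- by move=> u v /val_inj /(can_inj r2vK).
- by move=> u v; rewrite !linearD.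
- by move=> u; apply: subvsP.
by move=> v vH; exists (v2r (vsproj H v)); rewrite v2rK vsprojK.
Qed.

Theorem theorem15 (s : nat) (hs : (2 <= s)%N)
    (H : {vspace 'rV['F_2]_s}) (hH : (\dim H).+1 = s)
    (M : (2 ^ s.-1)%N.-tuple 'rV['F_2]_s)
    (hM0 : forall i, tnth M i != 0)
    (hMsum : \sum_i tnth M i = 0)
    (hM2 : #|[set i | tnth M i \in H]| = 2%N) :
  hadamard_pair_solution M.
Proof.
have dimH : \dim H = s.-1 := congr1 predn hH.
have [f [f_inj fD fH f_onto]] := exists_coordinates H.
have f0 : f 0 = 0 by apply: (addrI (f 0)); rewrite -fD !addr0.
have [g fK] : exists g, forall v, v \in H -> f (g v) = v.
  exists (fun v => odflt 0 [pick u | f u == v]) => v /f_onto[u fu].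
  by case: pickP => [w /eqP //|/(_ u)]; rewrite fu eqxx.
have [i [j [ij internal]]] : exists i j, i != j /\ [set k | tnth M k \in H] = [set i; j].
  by apply/cards2P; rewrite hM2.
have internalE k : (tnth M k \in H) = (k == i) || (k == j).
  by have /setP/(_ k) := internal; rewrite !inE.
have iH : tnth M i \in H by rewrite internalE eqxx.
have jH : tnth M j \in H by rewrite internalE eqxx orbT.
pose a := g (tnth M i); pose b := g (tnth M j).
have a0 : a != 0 by apply: contraNneq (hM0 i) => aE; rewrite -(fK _ iH) -/a aE f0.
have b0 : b != 0 by apply: contraNneq (hM0 j) => bE; rewrite -(fK _ jH) -/b bE f0.
have cardV : #|{: 'rV['F_2]_(\dim H)}| = #|{: 'I_(2 ^ s.-1)}|.
  by rewrite card_V card_ord dimH.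
have za : 0 != a by rewrite eq_sym.
(* [beta] reindexes the requests by coordinates of [H], with the internal ones at [0] and [a]. *)
have [beta [beta_bij beta0 betaa]] := exists_bijection_through cardV za ij.
have [e eH] : exists e, e \notin H.
  apply/existsP; rewrite -negb_forall; apply: contraT; rewrite negbK => /forallP allH.
  have : (fullv <= H)%VS by apply/subvP => v _.
  by move/dimvS; rewrite dimvf /dim /= mul1n dimH; lia.
pose h k := g (tnth M (beta k) + e).
have beta_crossing k : crossing a k -> f (h k) = tnth M (beta k) + e.
  case/andP=> k0 ka; apply: fK; apply: (add_notin_hyperplane hH) eH.
  by rewrite internalE -beta0 -betaa !(inj_eq (bij_inj beta_bij)) (negPf k0) (negPf ka).
(* This is the zero-sum hypothesis: the number of crossing requests is even, so the copies of [e]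
   cancel. *)
have bE : b = a + \sum_(k | crossing a k) h k.
  apply: f_inj; rewrite fD (big_morph f fD f0) (eq_bigr _ beta_crossing).
  rewrite big_split /= sumr_const.
  have -> : e *+ #|crossing a| = 0.
    have -> : #|crossing a| = (2 * (2 ^ (\dim H).-1 - 1))%N.
      have := cardC (mem [set 0; a]); rewrite cards2 za card_V.
      rewrite (eq_card (B := crossing a)); last by move=> k; rewrite !inE negb_or.
      move: #|crossing a| => c; have : (0 < \dim H)%N by lia.
      by case: (\dim H) => // m _; rewrite /= expnS; lia.
    by rewrite mulrnA mulr2n add_self mul0rn.
  move: hMsum; rewrite (reindex beta (onW_bij _ beta_bij)).
  rewrite (bigD1 (0 : 'rV['F_2]_(\dim H))) // (bigD1 a) //=.
  rewrite beta0 betaa !fK // addr0 => /eqP.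
  by rewrite addrA -addrA addrCA add_eq0_self => /eqP.
have [p [y [p0 pa q_inj]]] := bipartite_placement a0 b0 bE.
pose q := placement a h p y.
pose point (z : 'rV['F_2]_(\dim H) * bool) := f z.1 + (if z.2 then e else 0).
have point_inj : injective point.
  move=> [z c] [w d]; rewrite /point /=; case: c; case: d.
  - by move/addIr/f_inj->.
  - move=> E; have := fH w; rewrite -[f w]addr0 -E => /(rpredB (fH z)).
    by rewrite opprD addNKr rpredN (negPf eH).
  - move=> E; have := fH z; rewrite -[f z]addr0 E => /(rpredB (fH w)).
    by rewrite opprD addNKr rpredN (negPf eH).
  by move/addIr/f_inj->.
(* The flag [false] gives the point [p k] of [H], the flag [true] its partner in the coset of
   [e]. *)
pose slot (z : 'rV['F_2]_(\dim H) * bool) := (if z.2 then q (p z.1) else p z.1, z.2).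
have slot_inj : injective slot.
  move=> [z c] [w d] /= [E cd]; rewrite /= in E cd.
  by move: E; rewrite cd; case: d {cd} => [/q_inj|] /perm_inj->.
have [beta' betaK beta'K] := beta_bij.
(* The requests indexed by [0] and [a] must not pair [H] with its complement:
   the transposition makes the first take both points [0] and [a] of [H]. *)
pose F (u : 'I_(2 ^ s.-1) * bool) :=
  point (slot (tperm (0, true) (a, false) (beta' u.1, u.2))).
apply: (@hadamard_pair_solution_of_injection _ _ F); first exact: ltnW.
  move=> [i1 c1] [i2 c2] /point_inj/slot_inj/perm_inj[/= E ->].
  by rewrite (can_inj beta'K E).
move=> k; rewrite /F /= -{3}(beta'K k); move: (beta' k) => {}k.
have [->|k0] := eqVneq k 0.
  have -> : tperm (0, true) (a, false) (0, false) = (0, false).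
    by apply: tpermD; rewrite xpair_eqE ?andbF // (negPf a0).
  rewrite tpermL.
  by rewrite /point /slot /= p0 pa f0 !addr0 add0r beta0 fK.
have [->|ka] := eqVneq k a.
  have -> : tperm (0, true) (a, false) (a, true) = (a, true).
    by apply: tpermD; rewrite xpair_eqE ?andbF // (negPf za).
  rewrite tpermR.
  rewrite /point /slot /= p0 pa /q /placement !eqxx (negPf a0) -bE fD.
  by rewrite addrACA add_self addr0 addrA add_self add0r betaa fK.
have fixk d : tperm (0, true) (a, false) (k, d) = (k, d).
  by apply: tpermD; [apply: contra k0 | apply: contra ka] => /eqP[->].
rewrite !fixk.
have pk0 : p k != 0 by rewrite -p0 (inj_eq perm_inj).
have pka : p k != a by rewrite -[X in _ != X]pa (inj_eq perm_inj).
rewrite /point /slot /= /q /placement (negPf pk0) (negPf pka) permK fD.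
rewrite beta_crossing; last exact/andP.
by rewrite addr0 -!addrA add_self addr0 addrA add_self add0r.
Qed.
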